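(* Let $X,H,K,J$ satisfy the basic assumptions (i)–(iv) of the context, and let $g$, $u^\dagger$, $D$, $\Phi$, $\Psi$ satisfy the variational inequality assumption (VI) of the context. Assume in addition that the mapping $s\mapsto\Phi(s)^2/s$ is non-increasing and that the sequence of step sizes $\{\tau_1,\tau_2,\dots\}$ in the augmented Lagrangian method is bounded. For $\delta>0$ and $g^\delta\in H$ with $\|g-g^\delta\|\le\delta$, let $\{u_n^\delta\}_{n\ge1}$ be generated by the augmented Lagrangian method described in the context, and let $n^*(\delta)$ be chosen according to Morozov's discrepancy principle $$n^*(\delta)=\min\{n\in\mathbb{N}:\|Ku_n^\delta-g^\delta\|\le\rho\delta\}$$ for some $\rho>1$. Then there exists a constant $C>0$ independent of $\rho$ (and of $\delta$ and $g^\delta$) such that $$D(u_{n^*(\delta)}^\delta,u^\dagger)\le\frac{C(\rho+1)^2\delta^2}{\Psi^{-1}\bigl((\rho^2-1)\delta^2\bigr)}+C(\rho+1)^2\delta^2\sup_{k\in\mathbb{N}}\tau_k.$$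
   Context: Basic assumptions: (i) $X$ is a separable Banach space with dual $X^*$, and $H$ is a Hilbert space (identified with its dual). (ii) $K\colon X\to H$ is linear and continuous. (iii) $J\colon X\to\mathbb{R}\cup\{+\infty\}$ is convex, lower semicontinuous and proper, with nonempty domain $D(J)=\{u\in X: J(u)<\infty\}$. (iv) For each $h\in H$ and $c>0$ the set $\{u\in X:\|Ku-h\|^2+J(u)\le c\}$ is sequentially weakly pre-compact in $X$ (every sequence in it has a subsequence converging weakly in $X$). Exact problem: given $g\in H$, consider $\inf_{u\in X}J(u)$ subject to $Ku=g$. A solution is $u^\dagger\in X$ with $Ku^\dagger=g$, $J(u^\dagger)<\infty$ and $J(u^\dagger)\le J(u)$ for all $u$ with $Ku=g$. Augmented Lagrangian method (ALM): given $g^\delta\in H$, an initial value $p_0^\delta\in H$ and positive parameters $\{\tau_k\}_{k\in\mathbb{N}}$ with $t_n:=\sum_{k=1}^n\tau_k\to\infty$, compute for $k=1,2,\dots$ $$u_k^\delta\in\operatorname{argmin}_{u\in X}\Bigl[\frac{\tau_k}{2}\|Ku-g^\delta\|^2+J(u)-\langle p_{k-1}^\delta,Ku-g^\delta\rangle\Bigr],\qquad p_k^\delta=p_{k-1}^\delta+\tau_k(g^\delta-Ku_k^\delta).$$ Variational inequality assumption (VI): $\Phi\colon[0,\infty)\to[0,\infty)$ is an index function, i.e. continuous, strictly increasing and concave with $\Phi(0)=0$. $D\colon X\times X\to[0,\infty]$ satisfies $D(u,u)=0$ for all $u\in X$, and $u^\dagger$ is a solution of the exact problem such that $$D(u,u^\dagger)\le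 J(u)-J(u^\dagger)+\Phi(\|Ku-g\|^2)\qquad\text{for all }u\in X.$$ $\Psi$ is the Legendre–Fenchel conjugate of $\Phi^{-1}$, i.e. $\Psi(s)=\sup_{t\ge0}[st-\Phi^{-1}(t)]$ (with $\Phi^{-1}=+\infty$ outside the range of $\Phi$), and $\Psi^{-1}$ is the inverse function of $\Psi$.
   Formalization: The constant C may depend on a bound B for the norm of the initial value p_0^δ (the initial values are assumed to satisfy ‖p_0^δ‖ ≤ B, which includes any fixed initial value); with p_0^δ varying without bound as δ varies the claim fails. *)

(* Defs.v *)
From HB Require Import structures.
From mathcomp Require Import all_boot all_order all_algebra.
From mathcomp Require Import sesquilinear.
From mathcomp Require Import all_classical all_reals all_analysis.

Set Implicit Arguments.
Unset Strict Implicit.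
Unset Printing Implicit Defensive.

Import Order.TTheory GRing.Theory Num.Theory.
Import numFieldNormedType.Exports.

Local Open Scope classical_set_scope.
Local Open Scope ring_scope.

Definition separable_space (T : topologicalType) : Prop :=
  exists2 S : set T, countable S & dense S.

(* With [H : completeNormedModType R] and a real inner product on [H], this
   says that [H] is a Hilbert space for that inner product. *)
Definition inner_product_norm (R : realType) (H : normedModType R)
    (dot : {dot H for idfun}) : Prop :=
  forall h : H, dot h h = `|h| ^+ 2.

Definition weak_cvg (R : realType) (X : normedModType R)
    (x : nat -> X) (l : X) : Prop :=
  forall f : {linear X -> R^o}, continuous f -> f (x n) @[n --> \oo] --> f l.

(* The weak limit is not required to belong to [A]. *)
Definition seq_weakly_precompact (R : realType) (X : normedModType R)
    (A : set X) : Prop :=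
  forall x : nat -> X, (forall n, A (x n)) ->
    exists (s : nat -> nat) (l : X),
      {homo s : m n / (m < n)%N} /\ weak_cvg (x \o s) l.

Section extended_functionals.
Variables (R : realType) (X : normedModType R).
Implicit Type J : X -> \bar R.
Local Open Scope ereal_scope.

Definition proper_efun J : Prop :=
  (forall u, J u != -oo) /\ exists u, J u < +oo.

(* In [\bar R], [0 * +oo = 0], so the cases [t = 0] and [t = 1] are harmless. *)
Definition convex_efun J : Prop :=
  forall (u v : X) (t : R), (0 <= t <= 1)%R ->
    J (t *: u + (1 - t) *: v)%R <= t%:E * J u + (1 - t)%:E * J v.

End extended_functionals.

Definition is_argmin (R : realType) (X : Type) (F : X -> \bar R) (u : X) : Prop :=
  forall v, (F u <= F v)%E.

Section augmented_lagrangian.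
Variables (R : realType) (X H : normedModType R).
Variables (K : {linear X -> H}) (J : X -> \bar R).

Definition tikhonov_sublevel (h : H) (c : R) : set X :=
  [set u | ((`|K u - h| ^+ 2)%:E + J u <= c%:E)%E].

Definition exact_solution (g : H) (u : X) : Prop :=
  [/\ K u = g, (J u < +oo)%E & forall v, K v = g -> (J u <= J v)%E].

Variable dot : {dot H for idfun}.

Definition augmented_lagrangian (gd : H) (t : R) (p : H) (u : X) : \bar R :=
  ((t / 2 * `|K u - gd| ^+ 2)%:E + J u - (dot p (K u - gd))%:E)%E.

(* Steps are numbered from 1: [u 0] and [tau 0] play no role. *)
Definition alm (gd : H) (tau : nat -> R) (p0 : H) (u : nat -> X) (p : nat -> H)
    : Prop :=
  p 0%N = p0 /\
  forall k, (0 < k)%N ->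
    is_argmin (augmented_lagrangian gd (tau k) (p k.-1)) (u k) /\
    p k = p k.-1 + tau k *: (gd - K (u k)).

(* [n] is the least [n >= 1] with [`|K (u n) - gd| <= rho * delta]. *)
Definition morozov_index (gd : H) (rho delta : R) (u : nat -> X) (n : nat)
    : Prop :=
  [/\ (0 < n)%N, `|K (u n) - gd| <= rho * delta &
      forall m, (0 < m)%N -> `|K (u m) - gd| <= rho * delta -> (n <= m)%N].

End augmented_lagrangian.

Section index_functions.
Variable R : realType.
Implicit Type Phi : R -> R.

(* Functions on the half-line [0, +oo[ are represented by functions on [R]
   whose values at negative arguments are irrelevant. *)
Definition index_function Phi : Prop :=
  [/\ forall s, 0 <= s -> 0 <= Phi s,
      {within `[0, +oo[, continuous Phi},
      {in `[0, +oo[ &, {homo Phi : s t / s < t}},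
      convex_function (`[0, +oo[%classic : set R) (\- Phi) &
      Phi 0 = 0].

Definition index_inv Phi (t : R) : \bar R :=
  if t \in Phi @` `[0, +oo[
  then ('pinv_(fun=> 0) `[0, +oo[ Phi t)%:E else +oo%E.

Definition Psi Phi (s : R) : \bar R :=
  ereal_sup [set ((s * t)%:E - index_inv Phi t)%E | t in `[0, +oo[].

Definition Psi_inv Phi (y : R) : R :=
  'pinv_(fun=> 0) `[0, +oo[ (Psi Phi) y%:E.

End index_functions.

Definition variational_inequality (R : realType) (X H : normedModType R)
    (K : {linear X -> H}) (J : X -> \bar R) (g : H) (D : X -> X -> \bar R)
    (Phi : R -> R) (udag : X) : Prop :=
  forall u, (D u udag <= J u - J udag + (Phi (`|K u - g| ^+ 2))%:E)%E.

(* Main.v *)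
(* Write y = (rho^2 - 1) delta^2, s = Psi^-1(y) and w = 1/s + sup tau.  Since
   D >= 0, the variational inequality gives
   J(udag) - J(v) <= Phi(|K v - g|^2) <= (|K v - g|^2 + y) / s by Fenchel-Young,
   hence an approximate source element q of norm O(sqrt y / s) whose dual gap is
   O(y / s).  The p_k are proximal point iterates for the dual objective, so
   Gueler's estimate compares p_m with q; while the residual still exceeds
   rho delta this forces t_m = O(w) and |p_m| = O(w (rho + 1) delta).  One more
   step costs at most sup tau * rho delta, and
   J(u_n) - J(udag) <= <p_n, K u_n - g> concludes.
   The initial value p_0 is absorbed because y w^2 is bounded below: Psi(s) is
   at least of order s^2 for small s, while w >= sup tau for large s. *)

Require Import Defs.
From HB Require Import structures.
From mathcomp Require Import all_boot all_order all_algebra.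
From mathcomp Require Import sesquilinear.
From mathcomp Require Import all_classical all_reals all_analysis.
From mathcomp Require Import ring lra.

Set Implicit Arguments.
Unset Strict Implicit.
Unset Printing Implicit Defensive.

Import Order.TTheory GRing.Theory Num.Theory.
Import numFieldNormedType.Exports.

Local Open Scope classical_set_scope.
Local Open Scope ring_scope.

(** * Bilinear calculus and Cauchy-Schwarz for the inner product *)

Section dot_product.
Variables (R : realType) (H : normedModType R) (dot : {dot H for idfun}).

Lemma dotC (x y : H) : dot x y = dot y x.
Proof. by rewrite hermC /= expr0 mul1r. Qed.

Lemma dotDl (x y z : H) : dot (x + y) z = dot x z + dot y z.
Proof. exact: linearDl. Qed.

Lemma dotNl (x z : H) : dot (- x) z = - dot x z.
Proof. exact: linearNl. Qed.

Lemma dotZl (a : R) (x z : H) : dot (a *: x) z = a * dot x z.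
Proof. exact: linearZl_LR. Qed.

Lemma dotDr (x y z : H) : dot z (x + y) = dot z x + dot z y.
Proof. exact: linearDr. Qed.

Lemma dotNr (x z : H) : dot z (- x) = - dot z x.
Proof. exact: linearNr. Qed.

Lemma dotZr (a : R) (x z : H) : dot z (a *: x) = a * dot z x.
Proof. exact: linearZr_LR. Qed.

Definition dotE := (dotDl, dotNl, dotZl, dotDr, dotNr, dotZr).

Hypothesis dot_norm : inner_product_norm dot.

Lemma normD_sqr (x y : H) :
  `|x + y| ^+ 2 = `|x| ^+ 2 + 2 * dot x y + `|y| ^+ 2.
Proof. by rewrite -!dot_norm !dotE (dotC y x); ring. Qed.

Lemma normB_sqr (x y : H) :
  `|x - y| ^+ 2 = `|x| ^+ 2 - 2 * dot x y + `|y| ^+ 2.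
Proof. by rewrite normD_sqr dotNr normrN; ring. Qed.

(** Cauchy-Schwarz: expand the square of the norm of [|y| x - |x| y] and divide by [2 |x| |y|]. *)
Lemma dot_le_norm (x y : H) : dot x y <= `|x| * `|y|.
Proof.
have [->|x0] := eqVneq x 0; first by rewrite normr0 mul0r -(scale0r 0) dotZl mul0r.
have [->|y0] := eqVneq y 0; first by rewrite normr0 mulr0 -(scale0r 0) dotZr mul0r.
have px : 0 < `|x| by rewrite normr_gt0.
have py : 0 < `|y| by rewrite normr_gt0.
have : 0 <= `| (`|y| *: x) - (`|x| *: y) | ^+ 2 by rewrite sqr_ge0.
rewrite normB_sqr !dotE !normrZ !normr_id => h.
have : 0 <= 2 * (`|x| * `|y|) * (`|x| * `|y| - dot x y) by nra.
by rewrite pmulr_rge0 ?mulr_gt0// subr_ge0.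
Qed.

Lemma dot_ge_Nnorm (x y : H) : - (`|x| * `|y|) <= dot x y.
Proof. by have := dot_le_norm (- x) y; rewrite dotNl normrN lerNl. Qed.

End dot_product.

(** * The conjugate [Psi] and its inverse *)

Section conjugate.
Variables (R : realType) (Phi : R -> R).
Hypothesis Phi_index : index_function Phi.

Let Phi_gt0 (r : R) : 0 < r -> 0 < Phi r.
Proof.
move=> r0; case: Phi_index => _ _ + _ P0 => /(_ 0 r); rewrite !in_itv/= lexx !andbT.
by rewrite ltW// P0; exact.
Qed.

Let Phi_homo (r s : R) : 0 <= r -> r <= s -> Phi r <= Phi s.
Proof.
case: Phi_index => _ _ Phi_incr _ _ r0; rewrite le_eqVlt => /predU1P[->//|rs].
by apply/ltW/Phi_incr; rewrite ?in_itv/= ?andbT//; lra.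
Qed.

Let Phi_inj : {in (`[0, +oo[%classic : set R) &, injective Phi}.
Proof.
case: Phi_index => _ _ Phi_incr _ _ r s; rewrite !inE/= => r0 s0 rs.
by apply/eqP; rewrite eq_le !leNgt; apply/andP; split; apply/negP => h;
  [have := Phi_incr s r s0 r0 h | have := Phi_incr r s r0 s0 h];
  rewrite rs ltxx.
Qed.

Lemma index_inv_index (r : R) : 0 <= r -> index_inv Phi (Phi r) = r%:E.
Proof.
move=> r0; rewrite /index_inv ifT.
  by rewrite pinvKV// inE/= in_itv/= r0.
by rewrite inE/=; exists r => //=; rewrite in_itv/= r0.
Qed.

Lemma Psi_fenchel_young (s r : R) : 0 <= r -> ((s * Phi r - r)%:E <= Psi Phi s)%E.
Proof.
move=> r0; rewrite /Psi; apply: ereal_sup_ubound => /=; exists (Phi r).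
  by rewrite in_itv/= andbT; case: Phi_index => + _ _ _ _; exact.
by rewrite index_inv_index.
Qed.

(** Points outside the range of [Phi] contribute -oo to the supremum, so only [t = Phi r] has to be
    tested. *)
Lemma Psi_le (s : R) (y : \bar R) :
  (forall r, 0 <= r -> ((s * Phi r - r)%:E <= y)%E) -> (Psi Phi s <= y)%E.
Proof.
move=> h; apply: ge_ereal_sup => _ /= [t t0 <-]; rewrite /index_inv.
case: ifPn => [|_]; last by rewrite addeNy leNye.
rewrite inE/= => -[r r0 <-]; rewrite pinvKV//; last by rewrite inE.
by apply: h; move: r0; rewrite /= in_itv/= andbT.
Qed.

Hypothesis Phi_noninc : forall s t : R, 0 < s -> s <= t ->
  Phi t ^+ 2 / t <= Phi s ^+ 2 / s.

(** Comparison with the value at 1: [Phi r] lies above [Phi 1 * sqrt r] for [r <= 1] and, in the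
    next lemma, below it for [r >= 1]. *)
Let Phi_sqrt_ge (r : R) : 0 < r -> r <= 1 -> r * Phi 1 ^+ 2 <= Phi r ^+ 2.
Proof.
move=> r0 r1; have := Phi_noninc r0 r1.
by rewrite divr1 ler_pdivlMr// mulrC.
Qed.

Let Phi_sqrt_le (r : R) : 1 <= r -> Phi r ^+ 2 <= r * Phi 1 ^+ 2.
Proof.
move=> r1; have := Phi_noninc ltr01 r1.
by rewrite divr1 ler_pdivrMr 1?mulrC//; lra.
Qed.

(* [Psi s <= y] iff [s <= (y + r) / Phi r] for all [r > 0]; the growth bound
   [Phi r <= Phi 1 * sqrt r] keeps near-minimizers [r] bounded. *)
Lemma Psi_surjective (y : R) : 0 < y -> exists2 s, 0 < s & Psi Phi s = y%:E.
Proof.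
move=> y0.
pose E := [set (y + r) / Phi r | r in [set r : R | 0 < r]].
have E_gt0 (r : R) : 0 < r -> 0 < (y + r) / Phi r.
  by move=> r0; rewrite divr_gt0 ?Phi_gt0//; lra.
have E_inf : has_inf E.
  split; first by exists ((y + 1) / Phi 1); exists 1 => //=; lra.
  by exists 0 => _ [r r0 <-]; apply/ltW/E_gt0.
pose s := inf E.
have sE (r : R) : 0 < r -> s * Phi r <= y + r.
  move=> r0; rewrite -ler_pdivlMr ?Phi_gt0//.
  by apply: ge_inf; [exact: E_inf.2 | exists r].
have P1 : 0 < Phi 1 by rewrite Phi_gt0.
have P0 : Phi 0 = 0 by case: Phi_index.
have s_gt0 : 0 < s.
  (* The infimum stays away from 0: [y / Phi r >= y / Phi 1] for [r <= 1], and
     [r / Phi r >= 1 / Phi 1] for [r >= 1]. *)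
  apply: (@lt_le_trans _ _ (Num.min (y / Phi 1) (1 / Phi 1))).
    by rewrite lt_min !divr_gt0//.
  apply: lb_le_inf; first exact: E_inf.1.
  move=> _ [r /= r0 <-]; rewrite ge_min.
  have [r1|/ltW r1] := leP r 1; apply/orP; [left|right].
    rewrite ler_pdivrMr// mulrAC ler_pdivlMr ?Phi_gt0//.
    apply: ler_pM; [exact: ltW|exact/ltW/Phi_gt0|by rewrite lerDl ltW|].
    exact: Phi_homo (ltW r0) r1.
  rewrite ler_pdivrMr// mulrAC ler_pdivlMr ?Phi_gt0// mul1r.
  have : Phi r <= r * Phi 1.
    rewrite -(@ler_pXn2r _ 2)// ?nnegrE;
      [|exact/ltW/Phi_gt0|by rewrite mulr_ge0// ltW].
    apply: le_trans (Phi_sqrt_le r1) _.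
    by rewrite exprMn ler_wpM2r ?sqr_ge0// ler_eXnr.
  by have := mulr_gt0 y0 P1; rewrite mulrDl; lra.
exists s => //; apply/eqP; rewrite eq_le; apply/andP; split.
  apply: Psi_le => r; rewrite le_eqVlt => /predU1P[<-|r0].
    by rewrite P0 lee_fin; lra.
  by rewrite lee_fin; have := sE _ r0; lra.
apply/lee_addgt0Pr => e e0.
(* A point [r >= 1] within 1 of the infimum satisfies [r <= (s + 1) Phi r <= (s + 1) Phi 1 sqrt r],
   hence [r <= r1]; the choice of [eta] then makes the defect [eta * Phi r] at most [e]. *)
pose r1 := 1 + (Phi 1 * (s + 1)) ^+ 2.
have r1_ge1 : 1 <= r1 by rewrite lerDl sqr_ge0.
have Pr1 : 0 < Phi r1 by apply: Phi_gt0; lra.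
pose eta := Num.min 1 (e / Phi r1).
have eta0 : 0 < eta by rewrite lt_min ltr01 divr_gt0.
have [_ [r /= r0 <-]] := inf_adherent eta0 E_inf.
rewrite -/s ltr_pdivrMr ?Phi_gt0// => hr.
have Pr := Phi_gt0 r0.
have eta1 : eta <= 1 by rewrite ge_min lexx.
have rr1 : r <= r1.
  have [r_1|/ltW r_1] := leP r 1; first lra.
  have h1 : r <= (s + 1) * Phi r by nra.
  have h2 := Phi_sqrt_le r_1.
  suff : r <= (Phi 1 * (s + 1)) ^+ 2 by rewrite /r1; lra.
  have h3 : r ^+ 2 <= ((s + 1) * Phi r) ^+ 2 by rewrite lerXn2r ?nnegrE//; nra.
  have h4 : r * r <= r * (Phi 1 * (s + 1)) ^+ 2.
    apply: (@le_trans _ _ ((s + 1) ^+ 2 * Phi r ^+ 2)).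
      by rewrite -exprMn.
    have : 0 <= (s + 1) ^+ 2 by rewrite sqr_ge0.
    nra.
  by move: h4; rewrite ler_pM2l.
have h5 : eta * Phi r <= e.
  apply: (@le_trans _ _ (e / Phi r1 * Phi r1)); last by rewrite divfK// gt_eqF.
  apply: ler_pM; [exact: ltW|exact: ltW| |exact: Phi_homo (ltW r0) rr1].
  by rewrite ge_min lexx orbT.
apply: (@le_trans _ _ ((s * Phi r - r)%:E + e%:E)%E).
  by rewrite -EFinD lee_fin; lra.
by rewrite leeD2r// Psi_fenchel_young// ltW.
Qed.

(** The pseudo-inverse returns a preimage of [y] in the half-line, and 0 is excluded because
    [Psi Phi 0 <= 0 < y]. *)
Lemma Psi_invP (y : R) : 0 < y ->
  0 < Psi_inv Phi y /\ Psi Phi (Psi_inv Phi y) = y%:E.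
Proof.
move=> y0; have [s s0 sy] := Psi_surjective y0.
have yA : (Psi Phi @` `[0, +oo[) y%:E by exists s => //=; rewrite in_itv/= ltW.
have PsiK : Psi Phi (Psi_inv Phi y) = y%:E by rewrite /Psi_inv pinvK// inE.
split=> //; rewrite lt_def; apply/andP; split.
  apply/eqP => z; move: PsiK; rewrite z => PsiK0.
  have : (Psi Phi 0 <= 0)%E.
    by apply: Psi_le => r r0; rewrite lee_fin; lra.
  by rewrite PsiK0 lee_fin; lra.
have : (Psi_inv Phi y) \in `[0, +oo[.
  apply: (@surjpinv_image_sub _ _ (fun=> 0) `[0, +oo[%classic
    (Psi Phi @` `[0, +oo[) (Psi Phi)); first by move=> z.
  by exists y%:E.
by rewrite in_itv/= andbT.
Qed.

(** Gives a lower bound free of [rho] and [delta], against which the initial dual value is measured.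
    Small [s] are handled by [s^-1], large ones by [T]. *)
Lemma Psi_lower_bound (s T y : R) : 0 < s -> 0 < T -> Psi Phi s = y%:E ->
  Num.min (Phi 1 ^+ 2 / 4) (T ^+ 2) <= y * (s^-1 + T) ^+ 2.
Proof.
move=> s0 T0 sy.
have b0 : 0 < Phi 1 by exact: Phi_gt0.
have si : 0 < s^-1 by rewrite invr_gt0.
have FY r : 0 <= r -> s * Phi r - r <= y.
  by move=> r0; rewrite -lee_fin -sy Psi_fenchel_young.
have [h|/ltW h] := leP (s * Phi 1 / 2) 1.
  have q0 : 0 < s * Phi 1 / 2 by rewrite divr_gt0 ?mulr_gt0.
  (* The maximizer of [s * Phi 1 * sqrt r - r]. *)
  pose r := (s * Phi 1 / 2) ^+ 2.
  have r0 : 0 < r by rewrite exprn_gt0.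
  have r1 : r <= 1 by rewrite expr_le1// ltW.
  have h1 : s * Phi 1 / 2 * Phi 1 <= Phi r.
    rewrite -(@ler_pXn2r _ 2)// ?nnegrE;
      [|by rewrite mulr_ge0// ltW|exact/ltW/Phi_gt0].
    by rewrite exprMn Phi_sqrt_ge.
  have h2 : s ^+ 2 * (Phi 1 ^+ 2 / 4) <= y.
    apply: le_trans (FY r (ltW r0)).
    have : 0 <= s * (Phi r - s * Phi 1 / 2 * Phi 1).
      by apply: mulr_ge0; rewrite ?subr_ge0// ltW.
    by rewrite /r; lra.
  have y0 : 0 < y by apply: lt_le_trans h2; rewrite mulr_gt0 ?divr_gt0 ?exprn_gt0.
  rewrite ge_min; apply/orP; left.
  apply: (@le_trans _ _ (y * s^-1 ^+ 2)).
    by rewrite exprVn ler_pdivlMr ?exprn_gt0// mulrC.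
  by rewrite ler_pM2l// lerXn2r ?nnegrE; lra.
rewrite ge_min; apply/orP; right.
(* Here [s * Phi 1 >= 2], so testing at [r = 1] gives [y >= 1]. *)
have h1 := FY 1 ler01.
apply: (@le_trans _ _ (1 * (s^-1 + T) ^+ 2)).
  by rewrite mul1r lerXn2r ?nnegrE; lra.
by rewrite ler_wpM2r ?sqr_ge0//; lra.
Qed.

(** An affine majorant of [Phi] with slope [1 / s]; it makes the variational inequality quadratic in
    the residual. *)
Lemma index_le_Psi (s y x : R) : 0 < s -> Psi Phi s = y%:E -> 0 <= x ->
  Phi x <= (x + y) / s.
Proof.
move=> s0 sy x0; rewrite ler_pdivlMr// mulrC -lerBlDl -lee_fin -sy.
exact: Psi_fenchel_young.
Qed.

End conjugate.

(** * First-order conditions for approximate minimizers *)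

Section quadratic_perturbation.
Variables (R : realType) (X H : normedModType R) (dot : {dot H for idfun}).
Hypothesis dot_norm : inner_product_norm dot.
Variables (K : {linear X -> H}) (J : X -> \bar R).
Hypotheses (J_convex : convex_efun J) (J_proper : proper_efun J).

Let j u := fine (J u).

Lemma proper_fineK u : (J u < +oo)%E -> J u = (fine (J u))%:E.
Proof.
move=> Ju; rewrite fineK// fin_numE (J_proper.1 u)/=.
by move: Ju; rewrite lt_neqAle => /andP[].
Qed.

Lemma convex_fine u v (t : R) : (J u < +oo)%E -> (J v < +oo)%E -> 0 <= t <= 1 ->
  (J (t *: u + (1 - t) *: v)%R < +oo)%E /\
  j (t *: u + (1 - t) *: v) <= t * j u + (1 - t) * j v.
Proof.
move=> Ju Jv t01; have := J_convex u v t01.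
rewrite (proper_fineK Ju) (proper_fineK Jv) -!EFinM -EFinD => h.
have Jw := le_lt_trans h (ltry _); split => //.
by move: h; rewrite (proper_fineK Jw) lee_fin.
Qed.

(** Test minimality at [l v + (1 - l) u], use convexity and divide by [l]. Keeping [l] explicit
    balances the quadratic term [l * a] against the error [e / l]. *)
Lemma approx_min_first_order (a e l : R) (h p : H) (u v : X) :
  0 < l -> l <= 1 -> (J u < +oo)%E -> (J v < +oo)%E ->
  (forall w, (J w < +oo)%E ->
     a * `|K u - h| ^+ 2 + j u - dot p (K u - h) <=
     a * `|K w - h| ^+ 2 + j w - dot p (K w - h) + e) ->
  j u - j v <= dot (2 * a *: (K u - h) - p) (K v - K u)
               + l * a * `|K v - K u| ^+ 2 + e / l.
Proof.
move=> l0 l1 Ju Jv umin.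
have [Jw jw] := @convex_fine v u l Jv Ju (introT andP (conj (ltW l0) l1)).
have := umin _ Jw.
have -> : K (l *: v + (1 - l) *: u) - h = (K u - h) + l *: (K v - K u).
  by rewrite linearD !linearZ/= scalerBl scale1r scalerBr addrCA addrAC.
move: (K u - h) (K v - K u) => r d.
rewrite (normD_sqr dot_norm) normrZ ger0_norm ?(ltW l0)// !dotE.
move=> hu.
have := divfK (lt0r_neq0 l0) e.
rewrite -(ler_pM2l l0); move: (e / l) hu jw; rewrite /j => f hu jw fE; rewrite -fE in hu.
by move: hu jw; rewrite exprMn; lra.
Qed.

End quadratic_perturbation.

(** * Optimality condition of one augmented Lagrangian step *)

Section argmin.
Variables (R : realType) (X H : normedModType R) (dot : {dot H for idfun}).
Hypothesis dot_norm : inner_product_norm dot.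
Variables (K : {linear X -> H}) (J : X -> \bar R).
Hypotheses (J_convex : convex_efun J) (J_proper : proper_efun J).

(** The updated multiplier, pulled back by the adjoint of [K], is a subgradient of [J] at the
    minimizer: exact minimality allows [l] to tend to 0 in the first-order estimate. *)
Lemma argmin_subgradient (gd p : H) (t : R) (u : X) : 0 < t ->
  is_argmin (augmented_lagrangian K J dot gd t p) u ->
  (J u < +oo)%E /\
  forall v, (J v < +oo)%E ->
    fine (J u) - fine (J v) <= dot (p + t *: (gd - K u)) (K u - K v).
Proof.
move=> t0 umin.
have Ju : (J u < +oo)%E.
  have [v Jv] := J_proper.2; have := umin v; rewrite /augmented_lagrangian.
  rewrite (proper_fineK J_proper Jv); move: (J_proper.1 u).
  by case: (J u) => [x||]//; rewrite ltry.
split => // v Jv; apply/ler_addgt0Pr => e e0.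
set c := t / 2 * `|K v - K u| ^+ 2.
have c0 : 0 <= c by rewrite mulr_ge0 ?sqr_ge0 ?divr_ge0 ?ltW.
(* The added 1 keeps the denominator positive when [c = 0]; then [l * c <= e]. *)
pose l := Num.min 1 (e / (c + 1)).
have ec : 0 < e / (c + 1) by rewrite divr_gt0// ltr_wpDl.
have l0 : 0 < l by rewrite lt_min ltr01.
have l1 : l <= 1 by rewrite ge_min lexx.
have /(_ gd p) := @approx_min_first_order _ _ _ dot dot_norm K J J_convex J_proper
  (t / 2) 0 l.
move=> /(_ u v l0 l1 Ju Jv) h.
have {h} : fine (J u) - fine (J v) <=
    dot (2 * (t / 2) *: (K u - gd) - p) (K v - K u)
    + l * (t / 2) * `|K v - K u| ^+ 2 + 0 / l.
  apply: h => w Jw; have := umin w; rewrite /augmented_lagrangian.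
  rewrite (proper_fineK J_proper Jw) (proper_fineK J_proper Ju).
  by rewrite -!EFinD lee_fin addr0.
have le : l * c <= e.
  have : l * (c + 1) <= e by rewrite -ler_pdivlMr ?ltr_wpDl// ge_min lexx orbT.
  by rewrite mulrDr; lra.
have -> : dot (2 * (t / 2) *: (K u - gd) - p) (K v - K u) =
    dot (p + t *: (gd - K u)) (K u - K v).
  by rewrite !dotE; field.
by move: le; rewrite /c; lra.
Qed.

End argmin.

(** * Residuals and dual iterates of the method *)

Section iterates.
Variables (R : realType) (X H : normedModType R) (dot : {dot H for idfun}).
Hypothesis dot_norm : inner_product_norm dot.
Variables (K : {linear X -> H}) (J : X -> \bar R).
Hypotheses (J_convex : convex_efun J) (J_proper : proper_efun J).
Variables (gd p0 : H) (tau : nat -> R) (u : nat -> X) (p : nat -> H).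
Hypothesis tau_gt0 : forall k, (0 < k)%N -> 0 < tau k.
Hypothesis u_alm : alm K J dot gd tau p0 u p.

Let res k := gd - K (u k).
Let t m := \sum_(1 <= k < m.+1) tau k.

Lemma alm_dual_step k : p k.+1 = p k + tau k.+1 *: (gd - K (u k.+1)).
Proof. by have [_ /(_ k.+1 isT)[_]] := u_alm. Qed.

Lemma alm_subgradient k : (0 < k)%N -> (J (u k) < +oo)%E /\
  forall v, (J v < +oo)%E ->
    fine (J (u k)) - fine (J v) <= dot (p k) (K (u k) - K v).
Proof.
move=> k0; have [_ /(_ k k0)[umin ->]] := u_alm.
exact (argmin_subgradient dot_norm J_convex J_proper (tau_gt0 k0) umin).
Qed.

(** Adding the subgradient inequalities at steps [k] and [k + 1] gives [|r'|^2 <= <r', r>] for the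
    new residual [r']; Cauchy-Schwarz concludes. *)
Lemma alm_residual_decr k : (0 < k)%N -> `|res k.+1| <= `|res k|.
Proof.
move=> k0; have [J1 s1] := alm_subgradient k0.
have [J2 s2] := alm_subgradient (ltn0Sn k).
have := s1 _ J2; have := s2 _ J1; rewrite alm_dual_step -/(res k.+1).
have -> : K (u k.+1) - K (u k) = res k - res k.+1.
  by rewrite /res opprB [RHS]addrC subrKA.
have -> : K (u k) - K (u k.+1) = - (res k - res k.+1).
  by rewrite /res !opprB [RHS]addrC subrKA.
move: (res k) (res k.+1) => r r'; rewrite !dotE => h2 h1.
have : 0 <= tau k.+1 * (dot r' r - dot r' r') by lra.
rewrite pmulr_rge0 ?tau_gt0// dot_norm subr_ge0 => h.
have := le_trans h (dot_le_norm dot_norm _ _).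
have [->|r0] := eqVneq r' 0; first by rewrite normr0.
by rewrite expr2 ler_pM2l// normr_gt0.
Qed.

Lemma tau_sum_gt0 m : (0 < m)%N -> 0 < t m.
Proof.
rewrite /t; elim: m => [//|[|m] IH] _; first by rewrite big_nat1 tau_gt0.
by rewrite big_nat_recr//= addr_gt0 ?IH ?tau_gt0.
Qed.

(* [dual k] is the value of [J^*(K^* q) - <q, gd>] at [q = p k], because [u k]
   attains the supremum defining [J^*(K^* (p k))]. *)
Let dual k := - dot (p k) (res k) - fine (J (u k)).

(* Gueler's estimate for the proximal point iteration; [c] stands for the dual
   objective at [q]. *)
Lemma alm_dual_estimate (q : H) (c : R) m : (0 < m)%N ->
  (forall k, (0 < k <= m)%N -> - dot q (res k) - fine (J (u k)) <= c) ->
  t m * (dual m - c) + `|p m - q| ^+ 2 / 2 + t m ^+ 2 * `|res m| ^+ 2 / 2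
  <= `|p 0%N - q| ^+ 2 / 2.
Proof.
move=> m0 hc.
(* One proximal step compared with [q], by expanding [|p k - q|^2] around [p k.+1]. *)
have step k : (0 < k.+1 <= m)%N ->
    tau k.+1 * (dual k.+1 - c) <= (`|p k - q| ^+ 2 - `|p k.+1 - q| ^+ 2
      - tau k.+1 ^+ 2 * `|res k.+1| ^+ 2) / 2.
  move=> /hc h; have tk := tau_gt0 (ltn0Sn k).
  have -> : p k - q = (p k.+1 - q) - tau k.+1 *: res k.+1.
    by rewrite alm_dual_step [RHS]addrAC addrK.
  have -> : dual k.+1 = - dot (p k.+1 - q) (res k.+1) - dot q (res k.+1)
      - fine (J (u k.+1)) by rewrite /dual dotDl dotNl; lra.
  move: (res k.+1) (p k.+1 - q) h => r d h.
  rewrite (normB_sqr dot_norm) normrZ ger0_norm ?(ltW tk)// !dotE exprMn.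
  have : 0 <= tau k.+1 * (c - (- dot q r - fine (J (u k.+1)))).
    by apply: mulr_ge0; [exact: ltW|rewrite subr_ge0].
  lra.
elim: m m0 hc step => [//|[|m] IH] _ hc step.
  by have := step 0%N isT; rewrite /t big_nat1; lra.
have {}IH : t m.+1 * (dual m.+1 - c) + `|p m.+1 - q| ^+ 2 / 2
    + t m.+1 ^+ 2 * `|res m.+1| ^+ 2 / 2 <= `|p 0%N - q| ^+ 2 / 2.
  by apply: IH => // k /andP[k0 km]; [apply: hc|apply: step]; rewrite ?k0 leqW.
have {}step := step m.+1 (leqnn _).
have t_gt0 := tau_sum_gt0 (ltn0Sn m).
(* This descent, weighted by [t m.+1], pays for the cross term [2 t tau] when [t m.+2 ^+ 2] is
   expanded. *)
have dual_decr : 0 <= t m.+1 * (dual m.+1 - dual m.+2 - tau m.+2 * `|res m.+2| ^+ 2).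
  apply: mulr_ge0; first exact: ltW.
  have [J2 _] := alm_subgradient (ltn0Sn m.+1).
  have [_ /(_ _ J2)] := alm_subgradient (ltn0Sn m).
  have -> : K (u m.+1) - K (u m.+2) = res m.+2 - res m.+1.
    by rewrite /res opprB [RHS]addrC subrKA.
  rewrite /dual (alm_dual_step m.+1) -/(res m.+2) -dot_norm.
  by move: (res m.+1) (res m.+2) => r r'; rewrite !dotE; lra.
have res_decr : 0 <= t m.+1 ^+ 2 * (`|res m.+1| ^+ 2 - `|res m.+2| ^+ 2).
  rewrite mulr_ge0 ?sqr_ge0// subr_ge0 lerXn2r ?nnegrE//.
  exact: alm_residual_decr.
have -> : t m.+2 = t m.+1 + tau m.+2 by rewrite /t big_nat_recr.
move: IH step t_gt0 dual_decr res_decr.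
by move: (t m.+1) (dual m.+1) (dual m.+2) => a b d; lra.
Qed.

(** The subgradient inequality at [udag] bounds [dual m] below by [<p m, g - gd> - J udag]. The
    noise then contributes [t |p m - q| delta], absorbed by completing the square. *)
Lemma alm_dual_bound (udag : X) (g q : H) (delta e : R) m :
  (0 < m)%N -> (J udag < +oo)%E -> K udag = g -> `|g - gd| <= delta ->
  (forall k, (0 < k <= m)%N ->
     fine (J udag) - fine (J (u k)) + dot q (K (u k) - g) <= e) ->
  (`|p m - q| - t m * delta) ^+ 2 + t m ^+ 2 * (`|res m| ^+ 2 - delta ^+ 2)
  <= `|p 0%N - q| ^+ 2 + 2 * t m * e.
Proof.
move=> m0 Jdag Kdag g_gd he.
have := @alm_dual_estimate q (e - fine (J udag) + dot q (g - gd)) m m0.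
have h1 k : (0 < k <= m)%N ->
    - dot q (res k) - fine (J (u k)) <= e - fine (J udag) + dot q (g - gd).
  by move=> /he; rewrite /res !dotDr !dotNr; lra.
move=> /(_ h1) hG; have t0 := tau_sum_gt0 m0.
have [_ /(_ _ Jdag)] := alm_subgradient m0; rewrite Kdag => h2.
have h3 : - (`|p m - q| * delta) <= dot (p m - q) (g - gd).
  apply: le_trans (dot_ge_Nnorm dot_norm _ _).
  by rewrite lerN2 ler_wpM2l.
have : 0 <= t m * (dual m - (e - fine (J udag) + dot q (g - gd))
    + `|p m - q| * delta + e).
  apply: mulr_ge0; first exact: ltW.
  by move: h3 h2; rewrite /dual /res !dotDr !dotDl !dotNl !dotNr; lra.
by move: hG; set A := `|p m - q|; set S := `|res m|; lra.
Qed.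

End iterates.

(** * Construction of an approximate source element *)

Section approximate_source_element.
Variables (R : realType) (X H : normedModType R) (dot : {dot H for idfun}).
Hypothesis dot_norm : inner_product_norm dot.
Variables (K : {linear X -> H}) (J : X -> \bar R).
Hypotheses (J_convex : convex_efun J) (J_proper : proper_efun J).
Variables (udag : X) (g : H) (Phi : R -> R) (s y : R).
Hypotheses (Jdag : (J udag < +oo)%E) (Kdag : K udag = g).
Hypotheses (s_gt0 : 0 < s) (y_gt0 : 0 < y).
Hypothesis Phi_le : forall x, 0 <= x -> Phi x <= (x + y) / s.
Hypothesis J_VI : forall v, (J v < +oo)%E ->
  fine (J udag) - fine (J v) <= Phi (`|K v - g| ^+ 2).

(* [q] is the dual variable [- (4 / s) (K u - g)] of an almost-minimizer [u] of
   [J + (2 / s) `|K - g|^2]; almost-minimality makes the subgradient inequality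
   for [q] hold up to an error that is uniform for [K v] bounded. *)
Lemma approx_source_element (M : R) : exists q : H,
  `|q| ^+ 2 <= 32 * y / s ^+ 2 /\
  forall v, (J v < +oo)%E -> `|K v| <= M ->
    fine (J udag) - fine (J v) + dot q (K v - g) <= 2 * y / s.
Proof.
pose F v := 2 / s * `|K v - g| ^+ 2 + fine (J v).
have ys : 0 < y / s by rewrite divr_gt0.
have F_ge v : (J v < +oo)%E ->
    fine (J udag) + `|K v - g| ^+ 2 / s - y / s <= F v.
  move=> Jv; have := J_VI Jv; have := Phi_le (sqr_ge0 `|K v - g|).
  by rewrite /F; lra.
pose E := [set F v | v in [set v | (J v < +oo)%E]].
have E_inf : has_inf E.
  split; first by exists (F udag); exists udag.
  exists (fine (J udag) - y / s) => _ [v /= Jv <-].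
  apply: le_trans (F_ge v Jv); rewrite lerD2r lerDl divr_ge0 ?sqr_ge0//.
  exact: ltW.
(* [L] will bound [|K v - K u|^2]. Then [l] makes the quadratic remainder at most [y / s / 2], and
   [e] is set so that [e / l = y / s / 2]. *)
pose L := 2 * (M + `|g|) ^+ 2 + 4 * y.
have L0 : 0 < L by rewrite /L; have := sqr_ge0 (M + `|g|); have := y_gt0; lra.
pose l := Num.min 1 (y / (4 * L)).
have l0 : 0 < l by rewrite lt_min ltr01 divr_gt0 ?mulr_gt0.
have l1 : l <= 1 by rewrite ge_min lexx.
have lL : l * L <= y / 4.
  have : l * (4 * L) <= y.
    by rewrite -ler_pdivlMr ?mulr_gt0// ge_min lexx orbT.
  lra.
pose e := l * (y / s / 2).
have e0 : 0 < e by rewrite mulr_gt0// divr_gt0.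
have [_ [u /= Ju <-] hu] := inf_adherent e0 E_inf.
have umin w : (J w < +oo)%E -> F u <= F w + e.
  move=> Jw; apply/ltW/(lt_le_trans hu); rewrite lerD2r.
  by apply: ge_inf; [exact: E_inf.2|exists w].
have e_le : e <= y / s.
  have : l * (y / s / 2) <= 1 * (y / s / 2) by rewrite ler_wpM2r// divr_ge0// ltW.
  by rewrite /e; lra.
(* Compare with [F udag = J udag]: the penalty weight [2 / s] exceeds the slope [1 / s] of the
   majorant of [Phi], leaving [|K u - g|^2 / s] to be controlled. *)
have uN : `|K u - g| ^+ 2 <= 2 * y.
  have := F_ge _ Ju; have := umin _ Jdag.
  rewrite {2}/F Kdag subrr normr0 expr0n/= mulr0 => h1 h2.
  have : `|K u - g| ^+ 2 / s <= 2 * y / s by lra.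
  by rewrite ler_pM2r ?invr_gt0.
exists (- ((4 / s) *: (K u - g))); split.
  rewrite normrN normrZ exprMn ger0_norm ?divr_ge0 ?(ltW s_gt0)//.
  have -> : 32 * y / s ^+ 2 = (4 / s) ^+ 2 * (2 * y) by rewrite expr_div_n; ring.
  by rewrite ler_wpM2l ?sqr_ge0.
move=> v Jv KvM.
have := @approx_min_first_order _ _ _ dot dot_norm K J J_convex J_proper
  (2 / s) e l g 0 u v l0 l1 Ju Jv.
have z x : dot 0 x = 0 by rewrite -(scale0r 0) dotZl mul0r.
have -> : e / l = y / s / 2 by rewrite /e mulrC mulKf ?gt_eqF.
have Kuv : `|K v - K u| ^+ 2 <= L.
  have h1 : `|K v - g| ^+ 2 <= (M + `|g|) ^+ 2.
    have := ler_normB (K v) g; have := normr_ge0 (K v); have := normr_ge0 g.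
    by move=> *; rewrite lerXn2r ?nnegrE//; lra.
  have -> : K v - K u = (K v - g) - (K u - g) by rewrite opprB subrKA.
  rewrite (normB_sqr dot_norm).
  have := sqr_ge0 `|(K v - g) + (K u - g)|; rewrite (normD_sqr dot_norm) /L.
  by move: h1 uN; lra.
have lK : l * (2 / s) * `|K v - K u| ^+ 2 <= y / s / 2.
  have : l * `|K v - K u| ^+ 2 <= y / 4.
    by apply: le_trans lL; rewrite ler_wpM2l// ltW.
  have : 0 < 2 / s by rewrite divr_gt0.
  nra.
move=> /(_ _)/wrap[w Jw|].
  by have := umin w Jw; rewrite /F !z; lra.
have -> : K v - g = (K v - K u) + (K u - g) by rewrite subrKA.
have := J_VI Ju; have := Phi_le (sqr_ge0 `|K u - g|).
move: lK uN; rewrite -!dot_norm; move: (K v - K u) (K u - g) => d r.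
rewrite !dotE !z => lK uN hP hV hm.
have : 0 <= dot r r / s by rewrite dot_norm divr_ge0 ?sqr_ge0 ?ltW.
by lra.
Qed.

End approximate_source_element.

(** * Growth of the dual variable up to the stopping index *)

Section morozov_bound.
Variables (R : realType) (X H : normedModType R) (dot : {dot H for idfun}).
Hypothesis dot_norm : inner_product_norm dot.
Variables (K : {linear X -> H}) (J : X -> \bar R).
Hypotheses (J_convex : convex_efun J) (J_proper : proper_efun J).
Variables (udag : X) (g : H) (Phi : R -> R) (s y : R).
Hypotheses (Jdag : (J udag < +oo)%E) (Kdag : K udag = g).
Hypotheses (s_gt0 : 0 < s) (y_gt0 : 0 < y).
Hypothesis Phi_le : forall x, 0 <= x -> Phi x <= (x + y) / s.
Hypothesis J_VI : forall v, (J v < +oo)%E ->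
  fine (J udag) - fine (J v) <= Phi (`|K v - g| ^+ 2).
Variables (gd p0 : H) (tau : nat -> R) (u : nat -> X) (p : nat -> H).
Hypothesis tau_gt0 : forall k, (0 < k)%N -> 0 < tau k.
Hypothesis u_alm : alm K J dot gd tau p0 u p.
Variables (rho delta w c : R).
Hypotheses (rho_gt1 : 1 < rho) (delta_gt0 : 0 < delta).
Hypothesis yE : y = (rho ^+ 2 - 1) * delta ^+ 2.
Hypothesis g_gd : `|g - gd| <= delta.
Hypothesis s_inv_le : s^-1 <= w.
Hypothesis c_ge0 : 0 <= c.
Hypothesis p0_le : `|p0| ^+ 2 <= c ^+ 2 * (y * w ^+ 2).

Let w_gt0 : 0 < w.
Proof. by apply: lt_le_trans s_inv_le; rewrite invr_gt0. Qed.

Let y_le : y <= (rho * delta) ^+ 2.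
Proof. by rewrite yE exprMn; have := sqr_ge0 delta; lra. Qed.

Let rd_gt0 : 0 < rho * delta.
Proof. by rewrite mulr_gt0// (lt_trans ltr01). Qed.

(** Takes square roots, using that [y] is at most the square of [rho * delta]. *)
Let sqr_le (a b z : R) : 0 <= b -> z ^+ 2 <= b ^+ 2 * (y * w ^+ 2) ->
  z <= b * (w * (rho * delta)).
Proof.
move=> b0 h; have wrd : 0 <= b * (w * (rho * delta)).
  by rewrite mulr_ge0// mulr_ge0// ltW.
have [z0|/ltW z0] := leP z 0; first exact: le_trans z0 wrd.
rewrite -(@ler_pXn2r _ 2)// ?nnegrE//; apply: le_trans h _.
rewrite exprMn ler_wpM2l ?sqr_ge0// exprMn mulrC ler_wpM2l ?sqr_ge0//.
Qed.

(** Residuals above [rho * delta] make [|res m|^2 - delta^2] at least [y], so the dual bound limits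
    first [t m] and then [|p m - q|]. *)
Lemma alm_dual_norm_before m :
  (forall k, (0 < k <= m)%N -> rho * delta < `|K (u k) - gd|) ->
  `|p m| <= (18 + 2 * c) * (w * ((rho + 1) * delta)).
Proof.
move=> u_gt.
have wd : 0 < w * delta by rewrite mulr_gt0.
have wrd : 0 < w * (rho * delta) by rewrite mulr_gt0.
case: m u_gt => [_|m u_gt].
  have -> : p 0%N = p0 by case: u_alm.
  have := sqr_le 0 c_ge0 p0_le.
  have : 0 <= c * (w * delta) by rewrite mulr_ge0// ltW.
  have : 0 <= c * (w * (rho * delta)) by rewrite mulr_ge0// ltW.
  lra.
(* The source element is only valid for bounded [K v]; finitely many iterates admit a crude bound,
   and [M] does not enter the estimates. *)
have [M uM] : exists M, forall k, (0 < k <= m.+1)%N -> `|K (u k)| <= M.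
  exists (\sum_(k < m.+2) `|K (u k)|) => k /andP[_ km].
  by rewrite (bigD1 (Ordinal (km : (k < m.+2)%N)))//= lerDl sumr_ge0.
have [q [q_le hq]] := approx_source_element dot_norm J_convex J_proper Jdag Kdag
  s_gt0 y_gt0 Phi_le J_VI M.
have := @alm_dual_bound _ _ _ _ dot_norm K J J_convex J_proper gd p0 tau u p
  tau_gt0 u_alm udag g q delta (2 * y / s) m.+1 isT Jdag Kdag g_gd.
move=> /(_ _)/wrap[k km|].
  apply: hq; last exact: uM.
  by have [] := alm_subgradient dot_norm J_convex J_proper tau_gt0 u_alm
    (proj1 (andP km)).
have t0 := tau_sum_gt0 tau_gt0 (ltn0Sn m).
have -> : p 0%N = p0 by case: u_alm.
set t := \sum_(1 <= k < m.+2) tau k in t0 *.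
rewrite [`|gd - _|]distrC; have := u_gt m.+1 (leqnn _).
move: (`|K _ - _|) => r hr.
have hr2 : (rho * delta) ^+ 2 <= r ^+ 2.
  by rewrite lerXn2r ?nnegrE ?(ltW rd_gt0) ?ltW// (lt_trans rd_gt0).
have [y_ge0 w_ge0 t_ge0] := And3 (ltW y_gt0) (ltW w_gt0) (ltW t0).
have yw : 0 < y * w ^+ 2 by rewrite mulr_gt0 ?exprn_gt0.
have cyw : 0 <= c * (y * w ^+ 2) by rewrite mulr_ge0// ltW.
have c2yw : 0 <= c ^+ 2 * (y * w ^+ 2) by rewrite mulr_ge0 ?sqr_ge0// ltW.
have q_le2 : `|q| ^+ 2 <= 32 * (y * w ^+ 2).
  apply: le_trans q_le _; rewrite -mulrA ler_pM2l// ler_pM2l// -exprVn.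
  by rewrite lerXn2r ?nnegrE ?invr_ge0//; exact: ltW.
have pq : `|p0 - q| ^+ 2 <= (2 * c ^+ 2 + 64) * (y * w ^+ 2).
  rewrite (normB_sqr dot_norm).
  by have := sqr_ge0 `|p0 + q|; move: p0_le; rewrite (normD_sqr dot_norm); lra.
have te : 2 * t * (2 * y / s) <= 4 * t * (y * w).
  have : t * y * s^-1 <= t * y * w by rewrite ler_pM2l// mulr_gt0.
  lra.
have : `|p m.+1| <= `|p m.+1 - q| + `|q|.
  by rewrite -{1}(subrK q (p m.+1)) ler_normD.
move: (`|p m.+1 - q|) => A pA hA.
have tr : t ^+ 2 * y <= t ^+ 2 * (r ^+ 2 - delta ^+ 2).
  by rewrite ler_pM2l ?exprn_gt0// yE; move: hr2; rewrite exprMn; lra.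
(* Otherwise [t^2 <= (2 c^2 + 64) w^2 + 4 t w] would contradict
   [(8 + 2 c) (12 + 2 c) > 2 c^2 + 64]. *)
have t_le : t <= (12 + 2 * c) * w.
  rewrite leNgt; apply/negP => tw.
  have h1 : t ^+ 2 * y <= (2 * c ^+ 2 + 64) * (y * w ^+ 2) + 4 * t * (y * w).
    by have := sqr_ge0 (A - t * delta); lra.
  have h2 : y * (t * ((12 + 2 * c) * w)) < y * (t * t).
    by rewrite ltr_pM2l// ltr_pM2l.
  have h3 : (8 + 2 * c) * (y * w) * ((12 + 2 * c) * w) <= (8 + 2 * c) * (y * w) * t.
    by apply: ler_wpM2l (ltW tw); rewrite mulr_ge0// ?addr_ge0 ?mulr_ge0.
  lra.
have A_le : A - t * delta <= (12 + 2 * c) * (w * (rho * delta)).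
  apply: (sqr_le 0); first by rewrite addr_ge0// mulr_ge0.
  have h1 : t * (y * w) <= (12 + 2 * c) * w * (y * w).
    by rewrite ler_wpM2r// mulr_ge0.
  have : 0 <= t ^+ 2 * y by rewrite mulr_ge0 ?sqr_ge0.
  lra.
have q_le3 : `|q| <= 6 * (w * (rho * delta)).
  by apply: (sqr_le 0) => //; lra.
have td : t * delta <= (12 + 2 * c) * w * delta by rewrite ler_pM2r.
lra.
Qed.

(** The previous bound holds at [n - 1], possibly 0; the last update adds at most
    [w * (rho * delta)]. *)
Lemma alm_dual_norm_at n : (0 < n)%N -> tau n <= w ->
  `|K (u n) - gd| <= rho * delta ->
  (forall k, (0 < k < n)%N -> rho * delta < `|K (u k) - gd|) ->
  `|p n| <= (19 + 2 * c) * (w * ((rho + 1) * delta)).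
Proof.
case: n => // n _ tauT un u_gt.
have hp := @alm_dual_norm_before n u_gt.
rewrite (alm_dual_step u_alm); apply: (le_trans (ler_normD _ _)).
rewrite normrZ distrC gtr0_norm ?tau_gt0//.
have wd : 0 < w * delta by rewrite mulr_gt0.
have : tau n.+1 * `|K (u n.+1) - gd| <= w * (rho * delta).
  by apply: ler_pM => //; rewrite ltW ?tau_gt0.
lra.
Qed.

End morozov_bound.

(** * The error estimate at the discrepancy index *)

Theorem theorem4p2 (R : realType)
  (X : completeNormedModType R) (X_separable : separable_space X)
  (H : completeNormedModType R) (dot : {dot H for idfun})
  (dot_norm : inner_product_norm dot)
  (K : {linear X -> H}) (K_continuous : continuous K)
  (J : X -> \bar R) (J_convex : convex_efun J)
  (J_lsc : lower_semicontinuous J) (J_proper : proper_efun J)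
  (J_precompact : forall (h : H) (c : R), 0 < c ->
     seq_weakly_precompact (tikhonov_sublevel K J h c))
  (g : H) (udag : X) (udag_solution : exact_solution K J g udag)
  (Phi : R -> R) (Phi_index : index_function Phi)
  (D : X -> X -> \bar R) (D_ge0 : forall u v, (0 <= D u v)%E)
  (D_diag : forall u, D u u = 0%E)
  (VI : variational_inequality K J g D Phi udag)
  (Phi_noninc : forall s t : R, 0 < s -> s <= t ->
     Phi t ^+ 2 / t <= Phi s ^+ 2 / s)
  (tau : nat -> R) (tau_gt0 : forall k, (0 < k)%N -> 0 < tau k)
  (tau_sum : \sum_(1 <= k < n.+1) tau k @[n --> \oo] --> +oo)
  (tau_bounded : has_ubound [set tau k | k in [set k | (0 < k)%N]])
  (B : R) :
  exists C : R, 0 < C /\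
    forall (rho delta : R) (gd p0 : H) (u : nat -> X) (p : nat -> H) (n : nat),
      1 < rho -> 0 < delta -> `|g - gd| <= delta -> `|p0| <= B ->
      alm K J dot gd tau p0 u p ->
      morozov_index K gd rho delta u n ->
      (D (u n) udag <=
        (C * (rho + 1) ^+ 2 * delta ^+ 2
           / Psi_inv Phi ((rho ^+ 2 - 1) * delta ^+ 2)
         + C * (rho + 1) ^+ 2 * delta ^+ 2
           * sup [set tau k | k in [set k | (0 < k)%N]])%:E)%E.
Proof.
have [Kdag Jdag _] := udag_solution.
have Phi1 : 0 < Phi 1.
  case: Phi_index => _ _ + _ P0 => /(_ 0 1); rewrite !in_itv/= lexx ler01 P0.
  by apply.
pose T := sup [set tau k | k in [set k | (0 < k)%N]].
have tauT k : (0 < k)%N -> tau k <= T.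
  move=> k0; apply: ub_le_sup => //; by exists k.
have T_gt0 : 0 < T by apply: lt_le_trans (tauT 1%N isT); exact: tau_gt0.
pose m0 := Num.min (Phi 1 ^+ 2 / 4) (T ^+ 2).
have m0_gt0 : 0 < m0 by rewrite lt_min divr_gt0 ?exprn_gt0.
(* Since [(x + 1)^2 >= x] for [x >= 0], this yields [c^2 * m0 >= B^2]. *)
pose c := B ^+ 2 / m0 + 1.
have Bm0 : 0 <= B ^+ 2 / m0 by rewrite divr_ge0 ?sqr_ge0// ltW.
have c_ge0 : 0 <= c by rewrite addr_ge0.
(* [19 + 2 c] bounds the dual pairing and 2 the [Phi] term; [c] depends only on [B], [Phi] and the
   step sizes. *)
exists (21 + 2 * c); split; first by rewrite ltr_wpDr ?mulr_ge0.
move=> rho delta gd p0 u p n rho1 delta0 g_gd p0B u_alm [n0 un n_min].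
rewrite -/T; set y := (rho ^+ 2 - 1) * delta ^+ 2.
have y0 : 0 < y by rewrite mulr_gt0 ?exprn_gt0// subr_gt0 exprn_egt1.
have [] := Psi_invP Phi_index Phi_noninc y0.
set s := Psi_inv Phi y => s0 sy.
have Phi_le x : 0 <= x -> Phi x <= (x + y) / s.
  by move=> x0; exact: (index_le_Psi Phi_index s0 sy x0).
have J_VI v : (J v < +oo)%E -> fine (J udag) - fine (J v) <= Phi (`|K v - g| ^+ 2).
  move=> Jv; have := le_trans (D_ge0 v udag) (VI v).
  rewrite (proper_fineK J_proper Jv) (proper_fineK J_proper Jdag).
  by rewrite -!EFinD lee_fin; lra.
(* The two summands of [w] produce the two terms of the final bound. *)
pose w := s^-1 + T.
have sw : s^-1 <= w by rewrite lerDl ltW.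
have tauw : tau n <= w.
  by apply: (le_trans (tauT n n0)); rewrite lerDr invr_ge0 ltW.
have p0_le : `|p0| ^+ 2 <= c ^+ 2 * (y * w ^+ 2).
  have B0 : 0 <= B := le_trans (normr_ge0 p0) p0B.
  apply: (@le_trans _ _ (B ^+ 2)); first by rewrite lerXn2r ?nnegrE.
  apply: (@le_trans _ _ (c ^+ 2 * m0)).
    have : B ^+ 2 / m0 * m0 <= c ^+ 2 * m0 by rewrite ler_pM2r// /c; nra.
    by rewrite divfK ?gt_eqF.
  by rewrite ler_wpM2l ?sqr_ge0//; exact: Psi_lower_bound.
have u_gt k : (0 < k < n)%N -> rho * delta < `|K (u k) - gd|.
  move=> /andP[k0 kn]; rewrite ltNge; apply/negP => /(n_min _ k0).
  by rewrite leqNgt kn.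
have pn := alm_dual_norm_at dot_norm J_convex J_proper Jdag Kdag s0 y0 Phi_le J_VI
  tau_gt0 u_alm rho1 delta0 erefl g_gd sw c_ge0 p0_le n0 tauw un u_gt.
have [Jn] := alm_subgradient dot_norm J_convex J_proper tau_gt0 u_alm n0.
move=> /(_ _ Jdag); rewrite Kdag => hJ.
set x := (rho + 1) * delta in pn.
have x0 : 0 < x by rewrite mulr_gt0// addr_gt0// (lt_trans ltr01).
have Kx : `|K (u n) - g| <= x.
  have := ler_distD gd (K (u n)) g; rewrite [`|gd - g|]distrC.
  by rewrite /x; lra.
have hdot : dot (p n) (K (u n) - g) <= (19 + 2 * c) * (w * x) * x.
  by apply: (le_trans (dot_le_norm dot_norm _ _)); apply: ler_pM.
have hPhi : Phi (`|K (u n) - g| ^+ 2) <= 2 * (w * x) * x.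
  apply: (le_trans (Phi_le _ (sqr_ge0 _))).
  apply: (@le_trans _ _ (2 * x ^+ 2 / s)).
    rewrite ler_pM2r ?invr_gt0//.
    have : `|K (u n) - g| ^+ 2 <= x ^+ 2 by rewrite lerXn2r ?nnegrE// ltW.
    have : y <= x ^+ 2.
      rewrite /y /x exprMn ler_wpM2r ?sqr_ge0//; nra.
    lra.
  have : 0 <= T * x ^+ 2 by rewrite mulr_ge0 ?sqr_ge0// ltW.
  by rewrite /w; lra.
apply: (le_trans (VI (u n))).
rewrite (proper_fineK J_proper Jn) (proper_fineK J_proper Jdag).
rewrite -!EFinD lee_fin.
move: hJ hdot hPhi; rewrite /w /x; lra.
Qed.
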